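(* For any $\epsilon\in(1/\sqrt n,1/4)$, any deterministic algorithm that queries entries of a bounded entry matrix $\mathbf A\in\mathbb{R}^{n\times n}$ (possibly adaptively) and outputs $\widetilde\sigma_1$ satisfying $|\sigma_1(\mathbf A)-\widetilde\sigma_1|\le\epsilon\cdot\max(n,\|\mathbf A\|_1)$ must read at least $\Omega(n/\epsilon^2)$ entries.
   Context: A matrix has bounded entries if all its entries have absolute value at most $1$. $\sigma_1(\mathbf A)=\|\mathbf A\|_2$ is the largest singular value and $\|\mathbf A\|_1$ the nuclear norm (sum of singular values). *)

(* Defs.v *)
From mathcomp Require Import all_boot all_order all_algebra.
From mathcomp Require Import polyrcf complex.
From mathcomp Require Import reals.

Set Implicit Arguments.
Unset Strict Implicit.
Unset Printing Implicit Defensive.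

Import Order.TTheory GRing.Theory Num.Theory.

Local Open Scope ring_scope.

(* rootsR p lists each real root once; every root is repeated here according
   to its multiplicity, so this is the full spectrum only when char_poly A
   splits over R, as it does for symmetric A (sym_char_poly below). *)
Definition eigenvalues (R : rcfType) (n : nat) (A : 'M[R]_n) : seq R :=
  flatten [seq nseq (mup x (char_poly A)) x | x <- rootsR (char_poly A)].

Definition singular_values (R : rcfType) (n : nat) (A : 'M[R]_n) : seq R :=
  [seq Num.sqrt x | x <- eigenvalues (A^T *m A)].

Definition sigma1 (R : rcfType) (n : nat) (A : 'M[R]_n) : R :=
  \big[Num.max/0]_(s <- singular_values A) s.

Definition nuclear_norm (R : rcfType) (n : nat) (A : 'M[R]_n) : R :=
  \sum_(s <- singular_values A) s.

Definition bounded_entries (R : rcfType) (n : nat) (A : 'M[R]_n) : Prop :=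
  forall i j, `|A i j| <= 1.

(* A deterministic adaptive algorithm is a decision tree: it either stops with
   an output, or reads the (i, j) entry and continues in a way that may depend
   arbitrarily on the real value read.  Every branch is finite, but there is no
   uniform bound on the depth. *)
Inductive query_algorithm (R : Type) (n : nat) : Type :=
| Output of R
| Query of 'I_n & 'I_n & (R -> query_algorithm R n).

Fixpoint run (R : Type) (n : nat) (alg : query_algorithm R n)
    (A : 'M[R]_n) : R :=
  match alg with
  | Output v => v
  | Query i j next => run (next (A i j)) A
  end.

(* A set, so that an entry queried several times counts once. *)
Fixpoint entries_read (R : Type) (n : nat) (alg : query_algorithm R n)
    (A : 'M[R]_n) : {set 'I_n * 'I_n} :=
  match alg with
  | Output _ => set0
  | Query i j next => (i, j) |: entries_read (next (A i j)) A
  end.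

Definition approximates_sigma1 (R : rcfType) (n : nat) (eps : R)
    (alg : query_algorithm R n) : Prop :=
  forall A : 'M[R]_n, bounded_entries A ->
    `|sigma1 A - run alg A| <= eps * Num.max n%:R (nuclear_norm A).

Lemma eigenvalues_perm (R : rcfType) (n : nat) (A : 'M[R]_n) (s : seq R) :
  char_poly A = \prod_(x <- s) ('X - x%:P) -> perm_eq (eigenvalues A) s.
Proof.
move=> Es; have p0 : char_poly A != 0 by rewrite monic_neq0 ?char_poly_monic.
have rE x : (x \in rootsR (char_poly A)) = (x \in s).
  by rewrite -roots_on_rootsR // in_itv /= Es root_prod_XsubC.
apply/allP => x _; apply/eqP => /=.
rewrite /eigenvalues count_flatten sumnE !big_map.
under eq_bigr => y _ do rewrite count_nseq Es mu_prod_XsubC.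
have u : uniq (rootsR (char_poly A)) := uniq_roots _ _ _.
case: (boolP (x \in s)) => xs; last first.
  rewrite big_seq big1 ?(count_memPn xs) // => y; rewrite rE => ys /=.
  by case: eqP ys => [->|]; rewrite ?mul0n // (negbTE xs).
rewrite (bigD1_seq x) ?rE //= eqxx mul1n big1 ?addn0 // => y /negbTE yx.
by rewrite yx mul0n.
Qed.

Lemma sym_char_poly (R : rcfType) (n : nat) (A : 'M[R]_n) : A^T = A ->
  char_poly A = \prod_(x <- eigenvalues A) ('X - x%:P).
Proof.
move=> sA; pose f := real_complex R; pose B := map_mx f A.
suff [s Es] : exists s : seq R, char_poly A = \prod_(x <- s) ('X - x%:P).
  by rewrite (perm_big _ (eigenvalues_perm Es)).
have hB : B \is hermsymmx.
  apply: realsym_hermsym; last first.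
    by apply/mxOverP => i j; rewrite mxE complex_real eqxx.
  by apply/is_hermitianmxP; rewrite expr0 scale1r map_mx_id // /B map_trmx sA.
have Dr := hermitian_spectral_diag_real hB.
have BE := orthomx_spectralP (hermitian_normalmx hB).
set P := spectralmx B in BE; set D := spectral_diag B in BE Dr.
have uP : P \in unitmx := spectral_unit B.
exists [seq complex.Re (D 0 i) | i <- enum 'I_n].
apply: (map_poly_inj f); rewrite map_char_poly -/B.
rewrite rmorph_prod big_map big_enum /=.
have -> : char_poly B = char_poly (diag_mx D).
  pose Q := map_mx polyC P.
  have uQ : map_mx polyC (invmx P) *m Q = 1%:M.
    by rewrite -map_mxM mulVmx // map_mx1.
  have -> : char_poly B = \det (map_mx polyC (invmx P) *m
                                char_poly_mx (diag_mx D) *m Q).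
    rewrite mulmxBr mulmxBl -!map_mxM -BE.
    by rewrite scalar_mxC -mulmxA uQ mulmx1.
  by rewrite !det_mulmx mulrAC -det_mulmx uQ det1 mul1r.
rewrite char_poly_trig ?diag_mx_is_trig //; apply: eq_bigr => i _.
rewrite mxE eqxx mulr1n map_polyXsubC; congr ('X - _%:P).
by rewrite /f /= RRe_real // (mxOverP Dr).
Qed.

Lemma size_singular_values (R : rcfType) (n : nat) (A : 'M[R]_n) :
  size (singular_values A) = n.
Proof.
have sA : (A^T *m A)^T = A^T *m A by rewrite trmx_mul trmxK.
have := size_char_poly (A^T *m A).
by rewrite (sym_char_poly sA) size_prod_XsubC size_map => -[].
Qed.

(* Main.v *)
Require Import Defs.
From mathcomp Require Import all_boot all_order all_algebra.
From mathcomp Require Import reals.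
From mathcomp Require Import ring lra.
Import Order.TTheory GRing.Theory Num.Theory.
Local Open Scope ring_scope.

(* The algorithm is run on the all-ones matrix J, for which sigma_1 and the
   nuclear norm both equal n, so it outputs at least 3n/4.  Let S be the set of
   entries it reads.  It gives the same output on the indicator matrix of S,
   whose Frobenius norm is sqrt |S|.  If |S| < n / (16 eps^2) then, as
   1 / eps^2 < n, the latter matrix has sigma_1 <= n / 4 and, by
   Cauchy-Schwarz, eps times its nuclear norm is at most n / 4, which forces an
   output of at most n / 2. *)

Lemma gram_sym (R : rcfType) (n : nat) (A : 'M[R]_n) :
  (A^T *m A)^T = A^T *m A.
Proof. by rewrite trmx_mul trmxK. Qed.

Lemma sum_sqr_row_gt0 (R : rcfType) (n : nat) (v : 'rV[R]_n) :
  v != 0 -> 0 < (v *m v^T) 0 0.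
Proof.
move=> v0; rewrite mxE lt_neqAle sumr_ge0 ?andbT; last first.
  by move=> j _; rewrite mxE -expr2 sqr_ge0.
apply: contra v0 => /eqP s0; apply/eqP/rowP => j; rewrite mxE.
have /(_ j isT) : forall j, true -> v 0 j * v^T j 0 = 0.
  apply: psumr_eq0P; last by rewrite -s0.
  by move=> k _; rewrite mxE -expr2 sqr_ge0.
by rewrite mxE => /eqP; rewrite mulf_eq0 orbb => /eqP.
Qed.

(** For a row eigenvector [v], the scalar [v *m A^T *m A *m v^T] is both [x] times the squared
    length of [v] and the squared length of [v *m A^T]. *)
Lemma gram_eigenvalue_ge0 (R : rcfType) (n : nat) (A : 'M[R]_n) (x : R) :
  eigenvalue (A^T *m A) x -> 0 <= x.
Proof.
case/eigenvalueP => v vE v0; have v_gt0 := sum_sqr_row_gt0 _ _ _ v0.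
have : 0 <= ((v *m A^T) *m (v *m A^T)^T) 0 0.
  by rewrite mxE sumr_ge0 // => j _; rewrite [_^T _ _]mxE -expr2 sqr_ge0.
rewrite trmx_mul trmxK -!mulmxA (mulmxA A^T) mulmxA vE -scalemxAl mxE.
by rewrite pmulr_lge0.
Qed.

Lemma mem_gram_eigenvalues (R : rcfType) (n : nat) (A : 'M[R]_n) (x : R) :
  (x \in eigenvalues (A^T *m A)) = eigenvalue (A^T *m A) x.
Proof.
by rewrite eigenvalue_root_char (sym_char_poly (gram_sym _ _ A)) root_prod_XsubC.
Qed.

Lemma singular_value_ge0 (R : rcfType) (n : nat) (A : 'M[R]_n) (s : R) :
  s \in singular_values A -> 0 <= s.
Proof. by case/mapP => x _ ->; apply: sqrtr_ge0. Qed.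

Lemma singular_value_eigen (R : rcfType) (n : nat) (A : 'M[R]_n) (s : R) :
  s \in singular_values A -> eigenvalue (A^T *m A) (s ^+ 2).
Proof.
case/mapP => x; rewrite mem_gram_eigenvalues => ex ->.
(* [Num.sqrt] sends negative numbers to 0, so undoing it needs the eigenvalue to be nonnegative. *)
by rewrite sqr_sqrtr // (gram_eigenvalue_ge0 _ _ _ _ ex).
Qed.

(** By symmetry [char_poly A] splits over [R], and both sides are the opposite of its coefficient of
    degree [n - 1]; hence the separate case [n = 0]. *)
Lemma sum_eigenvalues (R : rcfType) (n : nat) (A : 'M[R]_n) :
  A^T = A -> \sum_(x <- eigenvalues A) x = \tr A.
Proof.
move=> sA; have Ep := sym_char_poly sA.
have sz : size (eigenvalues A) = n.
  by have := size_char_poly A; rewrite Ep size_prod_XsubC => -[].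
case: (posnP n) => [n0|n_gt0].
  by rewrite [eigenvalues A]size0nil ?big_nil ?sz // /mxtrace; subst n; rewrite big_ord0.
apply: oppr_inj; rewrite -char_poly_trace // Ep.
by rewrite -coefPn_prod_XsubC sz // -lt0n.
Qed.

(** Both sides equal the trace of [A^T *m A], the squared Frobenius norm. *)
Lemma sum_sqr_singular_values (R : rcfType) (n : nat) (A : 'M[R]_n) :
  \sum_(s <- singular_values A) s ^+ 2 = \sum_i \sum_j A i j ^+ 2.
Proof.
have -> : \sum_(s <- singular_values A) s ^+ 2 =
          \sum_(x <- eigenvalues (A^T *m A)) x.
  rewrite big_map !(big_seq _ _ (eigenvalues _)); apply: eq_bigr => x.
  rewrite mem_gram_eigenvalues => /gram_eigenvalue_ge0 x0.
  by rewrite sqr_sqrtr.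
rewrite (sum_eigenvalues _ _ _ (gram_sym _ _ A)) exchange_big /=.
apply: eq_bigr => j _; rewrite mxE; apply: eq_bigr => i _.
by rewrite mxE expr2.
Qed.

Lemma singular_value_le_sigma1 (R : rcfType) (n : nat) (A : 'M[R]_n) (s : R) :
  s \in singular_values A -> s <= sigma1 A.
Proof. by move=> sA; apply: le_bigmax_seq. Qed.

Lemma sigma1_le (R : rcfType) (n : nat) (A : 'M[R]_n) (t : R) :
  0 <= t -> \sum_i \sum_j A i j ^+ 2 <= t ^+ 2 -> sigma1 A <= t.
Proof.
move=> t0; rewrite -sum_sqr_singular_values => le_t.
rewrite /sigma1 big_seq; apply: bigmax_le => // s sA.
rewrite -ler_sqr ?nnegrE ?(singular_value_ge0 _ _ _ _ sA) //.
apply: le_trans le_t; rewrite (big_rem s) //= lerDl.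
by apply: sumr_ge0 => x _; apply: sqr_ge0.
Qed.

(* AM-GM on each singular value, [2 t s <= s^2 + t^2], avoids the square root
   of Cauchy-Schwarz. *)
Lemma nuclear_norm_le (R : rcfType) (n : nat) (A : 'M[R]_n) (t : R) :
  t *+ 2 * nuclear_norm A <= \sum_i \sum_j A i j ^+ 2 + n%:R * t ^+ 2.
Proof.
rewrite -sum_sqr_singular_values.
have -> : n%:R * t ^+ 2 = \sum_(s <- singular_values A) t ^+ 2.
  by rewrite big_const_seq count_predT size_singular_values iter_addr addr0 mulr_natl.
rewrite -big_split mulr_sumr; apply: ler_sum => s _ /=.
by have := sqr_ge0 (s - t); nra.
Qed.

(** Termwise, [s ^+ 2 <= sigma1 A * s]. This serves to bound [sigma1] of the all-ones matrix from
    below. *)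
Lemma sum_sqr_le_sigma1_nuclear (R : rcfType) (n : nat) (A : 'M[R]_n) :
  \sum_i \sum_j A i j ^+ 2 <= sigma1 A * nuclear_norm A.
Proof.
rewrite -sum_sqr_singular_values mulr_sumr !(big_seq _ _ (singular_values A)).
apply: ler_sum => s sA; rewrite expr2.
by rewrite ler_wpM2r ?(singular_value_ge0 _ _ _ _ sA) ?singular_value_le_sigma1.
Qed.

Section AllOnes.
Variables (R : rcfType) (n : nat).
Let J : 'M[R]_n := const_mx 1.

Lemma sum_sqr_ones : \sum_i \sum_j J i j ^+ 2 = n%:R ^+ 2.
Proof.
under eq_bigr => i _ do under eq_bigr => j _ do rewrite mxE expr1n.
by rewrite !sumr_const !card_ord -mulrnA natrM expr2.
Qed.

(** The Gram matrix [G] of [J] satisfies [G *m G = n%:R ^+ 2 *: G], so [s] is 0 or [n]. The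
    quadratic form of the conclusion can be summed over all singular values without knowing
    multiplicities. *)
Lemma singular_value_ones (s : R) :
  s \in singular_values J -> s ^+ 2 = n%:R * s.
Proof.
move=> sJ; have s0 := singular_value_ge0 _ _ _ _ sJ.
have GE : J^T *m J = n%:R *: J.
  apply/matrixP => i j; rewrite !mxE.
  under eq_bigr => k _ do rewrite !mxE mulr1.
  by rewrite sumr_const card_ord mulr1.
have GG : (J^T *m J) *m (J^T *m J) = n%:R ^+ 2 *: (J^T *m J).
  have JJ : J *m J = n%:R *: J by rewrite -GE trmx_const.
  by rewrite GE -scalemxAr -scalemxAl JJ !scalerA expr2.
have /eigenvalueP [v vE v0] := singular_value_eigen _ _ _ _ sJ.
have : v *m ((J^T *m J) *m (J^T *m J)) = v *m (n%:R ^+ 2 *: (J^T *m J)).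
  by rewrite GG.
rewrite (mulmxA v) -scalemxAr vE -scalemxAl vE !scalerA => /eqP.
rewrite -subr_eq0 -scalerBl scaler_eq0 (negbTE v0) orbF -mulrBl mulf_eq0.
rewrite subr_eq0 eqrXn2 ?ler0n // expf_eq0 /=.
by case/orP => /eqP ->; rewrite ?expr0n ?mulr0 ?expr2.
Qed.

Lemma nuclear_norm_ones : (0 < n)%N -> nuclear_norm J = n%:R.
Proof.
move=> n0; have n0' : n%:R != 0 :> R by rewrite pnatr_eq0 -lt0n.
apply: (mulfI n0'); rewrite -[RHS]expr2 -sum_sqr_ones -sum_sqr_singular_values.
rewrite mulr_sumr !(big_seq _ _ (singular_values J)); apply: eq_bigr => s.
by move/singular_value_ones.
Qed.

Lemma sigma1_ones_ge : (0 < n)%N -> n%:R <= sigma1 J.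
Proof.
move=> n0; have n0' : 0 < n%:R :> R by rewrite ltr0n.
have := sum_sqr_le_sigma1_nuclear _ _ J.
by rewrite sum_sqr_ones nuclear_norm_ones // expr2 ler_pM2r.
Qed.

End AllOnes.

(** Agreement at each entry read sends both runs into the same branch, so it is enough to compare
    the matrices on the entries read on [A]. *)
Lemma run_agree (R : rcfType) (n : nat) (alg : query_algorithm R n)
    (A B : 'M[R]_n) :
  (forall i j, (i, j) \in entries_read alg A -> A i j = B i j) ->
  run alg A = run alg B.
Proof.
elim: alg => [//|i j next IH] /= AB.
rewrite -(AB i j) ?setU11 //; apply: IH => k l kl.
by apply: AB; rewrite in_setU1 kl orbT.
Qed.

(** Among the matrices that agree with the all-ones matrix on [S], this one has the least Frobenius
    norm. *)
Definition indicator_mx (R : rcfType) (n : nat) (S : {set 'I_n * 'I_n}) :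
    'M[R]_n :=
  \matrix_(i, j) ((i, j) \in S)%:R.

Lemma sum_sqr_indicator (R : rcfType) (n : nat) (S : {set 'I_n * 'I_n}) :
  \sum_i \sum_j indicator_mx R n S i j ^+ 2 = #|S|%:R.
Proof.
rewrite pair_bigA /= -sum1_card natr_sum [RHS]big_mkcond /=.
apply: eq_bigr => -[i j] _; rewrite mxE /=.
by case: (_ \in _); rewrite ?expr1n ?expr0n.
Qed.

Theorem theorem7 (R : realType) :
  exists2 c : R, 0 < c &
    forall (n : nat) (eps : R) (alg : query_algorithm R n),
      (0 < n)%N ->
      1 / Num.sqrt n%:R < eps ->
      eps < 1 / 4%:R ->
      approximates_sigma1 eps alg ->
      exists2 A : 'M[R]_n, bounded_entries A &
        c * (n%:R / eps ^+ 2) <= #|entries_read alg A|%:R.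
Proof.
exists 16%:R^-1; first by rewrite invr_gt0 ltr0n.
move=> n eps alg n_gt0 eps_gt eps_lt approx.
have n0 : 0 < n%:R :> R by rewrite ltr0n.
have sn0 : 0 < Num.sqrt n%:R :> R by rewrite sqrtr_gt0.
have eps0 : 0 < eps by apply: lt_trans eps_gt; rewrite divr_gt0.
have eps2_gt : 1 < n%:R * eps ^+ 2.
  have : 1 < eps * Num.sqrt n%:R by rewrite -ltr_pdivrMr.
  rewrite -[n%:R in X in _ -> X](sqr_sqrtr (ltW n0)); nra.
set J : 'M[R]_n := const_mx 1; set S := entries_read alg J.
have J_bd : bounded_entries J by move=> i j; rewrite mxE normr1.
exists J => //; rewrite -/S leNgt; apply/negP => S_lt.
set B := indicator_mx R n S.
have B_bd : bounded_entries B.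
  by move=> i j; rewrite mxE ger0_norm ?ler0n // lern1 leq_b1.
have runE : run alg J = run alg B.
  by apply: run_agree => i j; rewrite !mxE -/S => ->.
have S_lt' : 16%:R * eps ^+ 2 * #|S|%:R < n%:R.
  move: S_lt; rewrite mulrA ltr_pdivlMr ?exprn_gt0 //.
  by rewrite mulrC => ?; lra.
have BF := sum_sqr_indicator R n S; rewrite -/B in BF.
(* Here [#|S| < n / (16 eps^2) < n^2 / 16], the last step by [eps2_gt]. *)
have sB : sigma1 B <= n%:R / 4%:R.
  apply: sigma1_le; first by rewrite divr_ge0 ?ler0n.
  rewrite BF; have : 0 <= #|S|%:R :> R by apply: ler0n.
  nra.
have nB : eps * nuclear_norm B <= n%:R / 4%:R.
  (* With [t = 1 / (4 eps)], the assumed bound on [#|S|] is exactly [n t^2], which balances the two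
     terms and bounds the nuclear norm by [n t]. *)
  have := nuclear_norm_le _ _ B (4%:R * eps)^-1; rewrite BF.
  set t := _^-1; have tE : t * (4%:R * eps) = 1.
    by rewrite mulVf // mulf_neq0 ?pnatr_eq0 ?gt_eqF.
  move=> le_t.
  (* Multiplying by [(4 eps)^2] clears [t] and leaves a linear inequality in
     [eps * nuclear_norm B]. *)
  have := ler_wpM2r (sqr_ge0 (4%:R * eps)) le_t.
  have -> : t *+ 2 * nuclear_norm B * (4%:R * eps) ^+ 2 =
    t * (4%:R * eps) * (8%:R * (eps * nuclear_norm B)) by ring.
  have -> : (#|S|%:R + n%:R * t ^+ 2) * (4%:R * eps) ^+ 2 =
    16%:R * eps ^+ 2 * #|S|%:R + n%:R * (t * (4%:R * eps)) ^+ 2 by ring.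
  by rewrite tE; lra.
have eB : eps * Num.max n%:R (nuclear_norm B) <= n%:R / 4%:R.
  by case: (lerP n%:R (nuclear_norm B)) => _ //; nra.
have := approx B B_bd; have := approx J J_bd.
rewrite runE nuclear_norm_ones // maxxx !ler_norml.
have := sigma1_ones_ge R n n_gt0; rewrite -/J.
move=> sJ /andP [_ J_le] /andP [B_ge _].
have : eps * n%:R < n%:R / 4%:R by nra.
lra.
Qed.
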